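(* Let $\{S_t:t\in\mathbb{Z}^+\}$ be the observed process of a discrete-time three-state hidden Markov model with 1-step transition probability matrix $P$, stationary distribution $\mu=(\mu_1,\mu_2,\mu_3)$ and state-dependent probability matrix $\Pi$ with columns $\varphi_0,\dots,\varphi_{K-1}$. Let $-\lambda_1,-\lambda_2$ be the nonzero eigenvalues of $Q=P-I$ and $\nu=\mu_1a_2-\mu_2b_1$ the probability flux. Then for every observed state $i\in\{0,\dots,K-1\}$ and all positive integers $n,m$, $$\Pr\{S_0=S_n=S_{n+m}=i\}-\Pr\{S_0=S_m=S_{m+n}=i\}=\frac{\nu D}{\lambda_1-\lambda_2}\left[(1-\lambda_2)^n(1-\lambda_1)^m-(1-\lambda_1)^n(1-\lambda_2)^m\right],$$ where $D=(x-y)(y-z)(z-x)$ and $(x,y,z)'=\varphi_i$.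
   Context: Discrete-time three-state hidden Markov model: $\{C_t:t\in\mathbb{Z}^+\}$ (times $0,1,2,\dots$) is an irreducible, time-homogeneous Markov chain on $\{1,2,3\}$ with 1-step transition probability matrix $$P=\begin{pmatrix}1-a_2-a_3&a_2&a_3\\ b_1&1-b_1-b_3&b_3\\ c_1&c_2&1-c_1-c_2\end{pmatrix},$$ started from its stationary distribution $\mu=(\mu_1,\mu_2,\mu_3)$, $\mu_i>0$, $\sum_i\mu_i=1$. By stationarity $\mu_1a_2-\mu_2b_1=\mu_2b_3-\mu_3c_2=\mu_3c_1-\mu_1a_3$; this common value is the probability flux $\nu$. The state-dependent probability matrix $\Pi=(\pi(k\,|\,i))$, $i=1,2,3$, $k=0,\dots,K-1$, is a $3\times K$ matrix with nonnegative entries and rows summing to 1; $\varphi_k\in\mathbb{R}^3$ is its column indexed by $k$ and a prime denotes transpose. The observed process $\{S_t\}$ takes values in $\{0,\dots,K-1\}$; conditionally on the hidden state at time $t$, $S_t$ has law $\pi(\cdot\,|\,C_t)$ and is independent of all earlier observations and of the hidden chain before time $t$. Thus for integers $0\le t_1<\cdots<t_n$, $\Pr(S_{t_1}=s_1,\dots,S_{t_n}=s_n)=\mu\Lambda_{s_1}P^{t_2-t_1}\Lambda_{s_2}\cdots P^{t_n-t_{n-1}}\Lambda_{s_n}\vec e$, where $\Lambda_k=\mathrm{diag}(\varphi_k)$, $\vec e=(1,1,1)'$. The eigenvalues of $Q=P-I$ are $0,-\lambda_1,-\lambda_2$, where $\lambda_1,\lambda_2$ are nonzero and possibly complex. When $\lambda_1=\lambda_2$,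 formulas containing $\frac1{\lambda_1-\lambda_2}$ are read as limits $\lambda_2\to\lambda_1$ (so $\frac{(1-\lambda_2)^n(1-\lambda_1)^m-(1-\lambda_1)^n(1-\lambda_2)^m}{\lambda_1-\lambda_2}$ means $(n-m)(1-\lambda_1)^{n+m-1}$). *)

(* Defs.v *)
From HB Require Import structures.
From mathcomp Require Import all_boot all_order all_algebra.
From mathcomp Require Import complex.
From mathcomp Require Import all_classical all_reals all_analysis.

Set Implicit Arguments.
Unset Strict Implicit.
Unset Printing Implicit Defensive.

Import Order.TTheory GRing.Theory Num.Theory.
Local Open Scope classical_set_scope.
Local Open Scope ring_scope.
Local Open Scope complex_scope.

(* The hidden states 1, 2, 3 of the model, as elements of 'I_3. *)
Definition st1 : 'I_3 := @Ordinal 3 0 isT.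
Definition st2 : 'I_3 := @Ordinal 3 1 isT.
Definition st3 : 'I_3 := @Ordinal 3 2 isT.

Section Matrices.
Variable R : realType.

Definition stochastic (m n : nat) (A : 'M[R]_(m, n)) : Prop :=
  (forall i j, 0 <= A i j) /\ (forall i, \sum_j A i j = 1).

Definition irreducible_chain (P : 'M[R]_3) : Prop :=
  forall i j, exists n : nat, 0 < (P ^+ n) i j.

Definition stationary_distribution (mu : 'rV[R]_3) (P : 'M[R]_3) : Prop :=
  [/\ forall i, 0 < mu 0 i, \sum_i mu 0 i = 1 & mu *m P = mu].

(* mu_1 a_2 - mu_2 b_1, where a_2 and b_1 are the transition probabilities
   from 1 to 2 and from 2 to 1. *)
Definition flux (mu : 'rV[R]_3) (P : 'M[R]_3) : R :=
  mu 0 st1 * P st1 st2 - mu 0 st2 * P st2 st1.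

(* The eigenvalues of A in R[i], listed with algebraic multiplicity. *)
Definition spectrum (n : nat) (A : 'M[R]_n) (s : seq R[i]) : Prop :=
  char_poly (map_mx (real_complex R) A) = \prod_(z <- s) ('X - z%:P).

(* [(1 - l2)^n (1 - l1)^m - (1 - l1)^n (1 - l2)^m] / (l1 - l2), extended to
   l1 = l2 by its limit as l2 tends to l1. *)
Definition bracket_quotient (l1 l2 : R[i]) (n m : nat) : R[i] :=
  if l1 == l2 then (n%:R - m%:R) * (1 - l1) ^+ (n + m).-1
  else ((1 - l2) ^+ n * (1 - l1) ^+ m - (1 - l1) ^+ n * (1 - l2) ^+ m)
       / (l1 - l2).

End Matrices.

Section Processes.
Variables (d : measure_display) (T : measurableType d) (R : realType).
Variable Pr : probability T R.

Definition prob (A : set T) : R := fine (Pr A).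

(* Pr(A | B), meaningful only when Pr(B) is nonzero. *)
Definition cond_prob (A B : set T) : R := prob (A `&` B) / prob B.

Definition discrete_process (k : nat) (X : nat -> T -> 'I_k) : Prop :=
  forall t x, measurable [set w | X t w = x].

(* {X_0 = x_0, ..., X_(t-1) = x_(t-1)} *)
Definition history (k : nat) (X : nat -> T -> 'I_k) (t : nat)
    (x : nat -> 'I_k) : set T :=
  [set w | forall u, (u < t)%N -> X u w = x u].

Definition markov_chain (k : nat) (mu : 'rV[R]_k) (P : 'M[R]_k)
    (C : nat -> T -> 'I_k) : Prop :=
  [/\ discrete_process C,
      forall x, prob [set w | C 0%N w = x] = mu 0 x
    & forall t c x, prob (history C t.+1 c) != 0 ->
        cond_prob [set w | C t.+1 w = x] (history C t.+1 c) = P (c t) x].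

(* Without the last clause (no feedback from the observations to the hidden
   chain), C_(t+1) could depend on S_t while C is still a Markov chain, and the
   finite-dimensional laws of S would not be determined by mu, P and Pi. *)
Definition hidden_markov_model (k K : nat) (mu : 'rV[R]_k) (P : 'M[R]_k)
    (Pi : 'M[R]_(k, K)) (C : nat -> T -> 'I_k) (S : nat -> T -> 'I_K) : Prop :=
  [/\ markov_chain mu P C,
      discrete_process S,
      forall t c s y, prob (history C t.+1 c `&` history S t s) != 0 ->
        cond_prob [set w | S t w = y] (history C t.+1 c `&` history S t s)
        = Pi (c t) y
    & forall t c s x, prob (history C t.+1 c `&` history S t.+1 s) != 0 ->
        cond_prob [set w | C t.+1 w = x]
          (history C t.+1 c `&` history S t.+1 s)
        = cond_prob [set w | C t.+1 w = x] (history C t.+1 c)].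

End Processes.

(* Main.v *)
Require Import Defs.
From mathcomp Require Import all_boot all_order all_algebra.
From mathcomp Require Import complex ring zify.
From mathcomp Require Import all_classical all_reals all_analysis.
Set Implicit Arguments.
Unset Strict Implicit.
Unset Printing Implicit Defensive.
Import Order.TTheory GRing.Theory Num.Theory.
Local Open Scope classical_set_scope.
Local Open Scope ring_scope.
Local Open Scope complex_scope.

(** Write u = 1 - l1, v = 1 - l2, L = diag (x, y, z), and e for the column of
    ones. The model gives Pr(S_0 = S_n = S_(n+m) = i) = w(P^n, P^m) with
    w(A, B) = mu L A L B L e (prob_three_observations), so the left-hand side
    is the antisymmetric bilinear form w(A, B) - w(B, A) at (P^n, P^m).

    By Cayley-Hamilton (P - 1)(P - u)(P - v) = 0, so each column of
    (P - u)(P - v) is fixed by P, hence constant because the chain is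
    irreducible; stationarity of mu then makes (P - u)(P - v) a multiple of the
    rank-one projection E = e mu (quadratic_projection). Therefore every P^k is
    a combination of 1, P and E (pow_interpolation), the first two coefficients
    coming from the polynomial of degree at most 1 that interpolates X^k at u
    and v. The projection E drops out of the antisymmetric form: with E in one
    slot, w splits into the same product of two scalars whichever slot it is
    (three_point_stationary). What remains is a 2 x 2 determinant of
    coefficients times w(1, P) - w(P, 1) (three_point_swap). The determinant is,
    up to sign, the bracket quotient (bracket_quotientE), and
      w(1, P) - w(P, 1) = sum_(i, j) mu_i P_ij phi_i phi_j (phi_i - phi_j)
    only sees the antisymmetric part of mu_i P_ij, which for three states is
    determined by the flux (three_point_flux). *)

(** * Vectors and matrices fixed by an irreducible stochastic matrix *)

Definition all_ones (F : pzSemiRingType) (n : nat) : 'cV[F]_n := const_mx 1.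

Lemma pow_fixes_vector (F : comNzRingType) (n p : nat) (P : 'M[F]_n.+1)
    (H : 'M[F]_(n.+1, p)) (k : nat) :
  P *m H = H -> P ^+ k *m H = H.
Proof.
move=> PH; elim: k => [|k IHk]; first by rewrite expr0 mul1mx.
by rewrite exprSr -mulmxE -mulmxA PH.
Qed.

Lemma stochastic_ones (R : realType) (m n : nat) (P : 'M[R]_(m, n)) :
  stochastic P -> P *m all_ones R n = all_ones R m.
Proof.
case=> _ P1; apply/colP => i; rewrite !mxE -(P1 i).
by apply: eq_bigr => j _; rewrite mxE mulr1.
Qed.

Lemma stochastic_pow (R : realType) (n : nat) (P : 'M[R]_n.+1) (k : nat) :
  stochastic P -> stochastic (P ^+ k).
Proof.
move=> sP; split=> [|i].
  elim: k => [|k IHk] i j; first by rewrite expr0 mxE ler0n.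
  rewrite exprSr -mulmxE mxE; apply: sumr_ge0 => l _.
  by rewrite mulr_ge0 //; case: sP.
have /colP/(_ i) := pow_fixes_vector k (stochastic_ones sP).
rewrite !mxE => <-; apply: eq_bigr => j _.
by rewrite [all_ones _ _ _ _]mxE mulr1.
Qed.

(** Maximum principle. At a maximal entry i0 the average of the nonnegative gaps
    h i0 - h l under row i0 of P^k vanishes, so the gap vanishes at every j
    with (P^k) i0 j > 0; irreducibility supplies such a k for each j. *)
Lemma harmonic_vector_constant (R : realType) (P : 'M[R]_3) (h : 'cV[R]_3) :
  stochastic P -> irreducible_chain P -> P *m h = h ->
  forall i j, h i 0 = h j 0.
Proof.
move=> sP irrP Ph.
case: (@arg_maxP _ _ _ ord0 xpredT (fun i => h i 0) isT) => i0 _ hmax.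
suff eq_max j : h j 0 = h i0 0 by move=> i j; rewrite !eq_max.
have [k Pij_gt0] := irrP i0 j.
have [Pk_ge0 Pk1] := stochastic_pow k sP.
have gap0 : \sum_l (P ^+ k) i0 l * (h i0 0 - h l 0) = 0.
  rewrite (eq_bigr _ (fun l _ => mulrBr _ _ _)) big_split sumrN /=.
  rewrite -mulr_suml Pk1 mul1r.
  by have /colP/(_ i0) := pow_fixes_vector k Ph; rewrite mxE => ->; rewrite subrr.
have gap_ge0 l : true -> 0 <= (P ^+ k) i0 l * (h i0 0 - h l 0).
  by move=> _; rewrite mulr_ge0 // subr_ge0; apply: hmax.
have /eqP : (P ^+ k) i0 j * (h i0 0 - h j 0) = 0.
  exact: (psumr_eq0P gap_ge0 gap0).
by rewrite mulf_eq0 gt_eqF //= subr_eq0 => /eqP.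
Qed.

(** The eigenvalues may be complex, so the real statement is transferred to
    complex matrices through real and imaginary parts: a real matrix acts on
    both separately. *)
Lemma complex_harmonic_constant (R : realType) (P : 'M[R]_3) (p : nat)
    (H : 'M[R[i]]_(3, p)) :
  stochastic P -> irreducible_chain P ->
  map_mx (real_complex R) P *m H = H -> forall i j k, H i k = H j k.
Proof.
move=> sP irrP PH.
have part (f : R[i] -> R) : {morph f : a b / a + b} ->
    (forall (r : R) a, f (r%:C * a) = r * f a) ->
    forall i j k, f (H i k) = f (H j k).
  move=> fD fZ i j k.
  have f0 : f 0 = 0 by rewrite -(mul0r 0) (fZ 0 0) mul0r.
  have Pf : P *m (\col_l f (H l k)) = \col_l f (H l k).
    apply/colP => l; rewrite !mxE -[in RHS]PH mxE (big_morph f fD f0).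
    by apply: eq_bigr => a _; rewrite !mxE fZ.
  by have := harmonic_vector_constant sP irrP Pf i j; rewrite !mxE.
move=> i j k; apply/eqP; rewrite eq_complex.
apply/andP; split; apply/eqP; apply: part => [[a b] [a' b']|r [a b]] //=.
  by rewrite mul0r subr0.
by rewrite mul0r addr0.
Qed.

(** * Powers of the transition matrix *)

Lemma char_poly_annihilates (F : comNzRingType) (n : nat) (A : 'M[F]_n.+1)
    (s : seq F) :
  char_poly A = \prod_(z <- s) ('X - z%:P) -> \prod_(z <- s) (A - z%:M) = 0.
Proof.
move=> charA; rewrite -(Cayley_Hamilton A) charA rmorph_prod /=.
by apply: eq_bigr => z _; rewrite rmorphB /= horner_mx_X horner_mx_C.
Qed.

(** Cayley-Hamilton makes M = (P - (1 - l1)) (P - (1 - l2)) fixed by P from the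
    left, so its rows all agree; the common row is mu M, and mu is a left
    eigenvector of both factors. The constant is c = l1 l2. *)
Lemma quadratic_projection (R : realType) (P : 'M[R]_3) (mu : 'rV[R]_3)
    (l1 l2 : R[i]) :
  stochastic P -> irreducible_chain P -> stationary_distribution mu P ->
  spectrum (P - 1%:M) [:: 0; - l1; - l2] ->
  let PC := map_mx (real_complex R) P in
  exists c : R[i], (PC - (1 - l1)%:M) *m (PC - (1 - l2)%:M)
    = c *: (all_ones _ 3 *m map_mx (real_complex R) mu).
Proof.
move=> sP irrP [_ mu1 muP] specQ PC; set muC := map_mx _ mu.
set M := _ *m _.
have shift (a : R[i]) : PC - (1 - a)%:M = map_mx (real_complex R) (P - 1%:M) - (- a)%:M.
  rewrite map_mxB map_mx1 -/PC; apply/matrixP => i j; rewrite !mxE.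
  by case: (i == j); rewrite ?mulr1n ?mulr0n; ring.
have PM : PC *m M = M.
  apply/eqP; rewrite -subr_eq0 -{2}(mul1mx M) -mulmxBl.
  have := char_poly_annihilates specQ.
  rewrite !big_cons big_nil mulr1 -!shift raddf0 subr0 map_mxB map_mx1 -/PC.
  by rewrite -!mulmxE => ->.
have muCP : muC *m PC = muC by rewrite -map_mxM muP.
have muM : muC *m M = (l1 * l2) *: muC.
  have step a : muC *m (PC - (1 - a)%:M) = a *: muC.
    by rewrite mulmxBr muCP mul_mx_scalar scalerBl scale1r opprB addrC subrK.
  by rewrite mulmxA step -scalemxAl step scalerA.
exists (l1 * l2); rewrite scalemxAr -muM; clearbody M.
apply/matrixP => i k; rewrite !mxE big_ord1 mxE mul1r mxE.
(* The rows of M agree, so averaging them by mu returns any one of them. *)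
rewrite (eq_bigr (fun j => muC 0 j * M i k)); last first.
  by move=> j _; congr (_ * _); exact: (complex_harmonic_constant sP irrP PM).
rewrite -mulr_suml; under eq_bigr do rewrite mxE.
by rewrite -rmorph_sum /= mu1 mul1r.
Qed.

(** The divided difference (u^n - v^n) / (u - v) written as a polynomial, so
    that it also makes sense at u = v, where it is the derivative n u^(n-1). *)
Definition divided_power (F : comNzRingType) (u v : F) (n : nat) : F :=
  \sum_(i < n) u ^+ (n.-1 - i) * v ^+ i.

Lemma divided_powerS (F : comNzRingType) (u v : F) (n : nat) :
  divided_power u v n.+1 = u ^+ n + v * divided_power u v n.
Proof.
rewrite /divided_power big_ord_recl subn0 mulr1 big_distrr /=.
congr (_ + _); apply: eq_bigr => i _.
have -> : (n - lift ord0 i)%N = (n.-1 - i)%N by rewrite /= /bump; lia.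
by rewrite exprS mulrCA.
Qed.

(** Modulo (X - u)(X - v), the power X^k is its Newton interpolant
    u^k + (X - u) (u^k - v^k) / (u - v). The multiple of E that reducing by
    this quadratic leaves remains a multiple of E, since E P = E; only its
    existence is recorded, as three_point_swap cancels it. *)
Lemma pow_interpolation (F : comNzRingType) (n : nat) (P E : 'M[F]_n.+1)
    (u v c : F) (k : nat) :
  E *m P = E -> (P - u%:M) *m (P - v%:M) = c *: E ->
  exists g, P ^+ k = (u ^+ k - u * divided_power u v k)%:M
                     + divided_power u v k *: P + g *: E.
Proof.
move=> EP PuPv.
have P2 : P *m P = (u + v) *: P - (u * v)%:M + c *: E.
  rewrite -PuPv mulmxBl !mulmxBr mul_mx_scalar !mul_scalar_mx scale_scalar_mx.
  rewrite scalerDl opprB -[RHS]addrA; apply/matrixP=> i j; rewrite !mxE; ring.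
elim: k => [|k [g IHk]].
  by exists 0; rewrite /divided_power big_ord0 !(scale0r, addr0, mulr0, subr0, expr0).
exists (divided_power u v k * c + g).
rewrite exprSr IHk -mulmxE !mulmxDl mul_scalar_mx -!scalemxAl P2 EP.
rewrite divided_powerS exprS; apply/matrixP => i j; rewrite !mxE.
case: (i == j); rewrite ?mulr1n ?mulr0n; ring.
Qed.

(** The right-hand side is minus the 2 x 2 determinant of the coefficients of 1
    and P in P^n and P^m given by pow_interpolation. *)
Lemma bracket_quotientE (R : realType) (l1 l2 : R[i]) (n m : nat) :
  let beta := divided_power (1 - l1) (1 - l2) in
  bracket_quotient l1 l2 n m
  = (1 - l1) ^+ m * beta n - (1 - l1) ^+ n * beta m.
Proof.
move=> beta; rewrite /bracket_quotient.
have betaE k : (l2 - l1) * beta k = (1 - l1) ^+ k - (1 - l2) ^+ k.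
  by rewrite subrXX; congr (_ * _); ring.
case: eqP => [l12|/eqP]; last first.
  rewrite -subr_eq0 => l12; apply: (mulIf l12); rewrite divfK //.
  move: (betaE n) (betaE m).
  set a := (1 - l1) ^+ n; set b := (1 - l1) ^+ m => En Em.
  have -> : (1 - l2) ^+ n = a - (l2 - l1) * beta n by rewrite En; ring.
  have -> : (1 - l2) ^+ m = b - (l2 - l1) * beta m by rewrite Em; ring.
  ring.
(* Double eigenvalue: all k terms of the divided difference are equal. *)
have betaD k : beta k = k%:R * (1 - l1) ^+ k.-1.
  rewrite /beta /divided_power -l12 (eq_bigr (fun=> (1 - l1) ^+ k.-1)).
    by rewrite sumr_const card_ord mulr_natl.
  by move=> i _; rewrite -exprD subnK //; case: k i => [[]|k i] //=; rewrite -ltnS.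
rewrite !betaD; case: n m => [|n] [|m]; rewrite ?add0n ?addn0 /= ?expr0.
- ring.
- ring.
- ring.
- rewrite addnS !exprS exprD; ring.
Qed.

(** * The three-point functional *)

(** When L is the diagonal matrix of Pr(S_t = i | C_t), this is the probability
    of seeing i three times when A and B transport the hidden state between
    the observations. *)
Definition three_point (F : comNzRingType) (n : nat) (mu : 'rV[F]_n)
    (L A B : 'M[F]_n) : F :=
  (mu *m L *m A *m L *m B *m L *m all_ones F n) 0 0.

Lemma map_three_point (F G : comNzRingType) (f : {rmorphism F -> G}) (n : nat)
    (mu : 'rV[F]_n) (L A B : 'M[F]_n) :
  three_point (map_mx f mu) (map_mx f L) (map_mx f A) (map_mx f B)
  = f (three_point mu L A B).
Proof.
rewrite /three_point.
have -> : all_ones G n = map_mx f (all_ones F n) by rewrite map_const_mx rmorph1.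
by rewrite -!map_mxM mxE.
Qed.

(** The rank-one matrix e mu restarts the chain in stationarity, which makes
    the observations before and after it independent: both sides are the product of the scalars mu L e and
    mu L A L e. *)
Lemma three_point_stationary (F : comNzRingType) (n : nat) (mu : 'rV[F]_n)
    (L A : 'M[F]_n) :
  three_point mu L (all_ones F n *m mu) A = three_point mu L A (all_ones F n *m mu).
Proof.
have mul11 (U V : 'M[F]_1) : (U *m V) 0 0 = U 0 0 * V 0 0.
  by rewrite mxE big_ord1.
have -> : three_point mu L (all_ones F n *m mu) A
    = (mu *m L *m all_ones F n) 0 0 * (mu *m L *m A *m L *m all_ones F n) 0 0.
  by rewrite -mul11 /three_point !mulmxA.
have -> : three_point mu L A (all_ones F n *m mu)
    = (mu *m L *m A *m L *m all_ones F n) 0 0 * (mu *m L *m all_ones F n) 0 0.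
  by rewrite -mul11 /three_point !mulmxA.
exact: mulrC.
Qed.

(** An antisymmetric bilinear form on the span of 1, P and E is determined by
    its values at (1, P), (1, E) and (P, E); the last two vanish by
    three_point_stationary. *)
Lemma three_point_swap (F : comNzRingType) (n : nat) (mu : 'rV[F]_n)
    (L P : 'M[F]_n) (a b g a' b' g' : F) :
  let E := all_ones F n *m mu in
  let A := a%:M + b *: P + g *: E in
  let B := a'%:M + b' *: P + g' *: E in
  three_point mu L A B - three_point mu L B A
  = (a * b' - a' * b) * (three_point mu L 1%:M P - three_point mu L P 1%:M).
Proof.
move=> E A B.
have linl r s t X : three_point mu L (r%:M + s *: P + t *: E) X
    = r * three_point mu L 1%:M X + s * three_point mu L P X
      + t * three_point mu L E X.
  rewrite /three_point -[r%:M]scalemx1 !mulmxDr !mulmxDl -!scalemxAr -!scalemxAl.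
  by rewrite !mxE.
have linr r s t X : three_point mu L X (r%:M + s *: P + t *: E)
    = r * three_point mu L X 1%:M + s * three_point mu L X P
      + t * three_point mu L X E.
  rewrite /three_point -[r%:M]scalemx1 !mulmxDr !mulmxDl -!scalemxAr -!scalemxAl.
  by rewrite !mxE.
by rewrite !linl !linr !three_point_stationary; ring.
Qed.

(** The left-hand side is the sum of mu_i P_ij phi_i phi_j (phi_i - phi_j). Pairing
    (i, j) with (j, i) leaves the net flow along each edge of the triangle
    1, 2, 3; stationarity makes the three net flows around it equal to the flux,
    and x y (x - y) + y z (y - z) + z x (z - x) = - (x - y) (y - z) (z - x). *)
Lemma three_point_flux (R : realType) (mu : 'rV[R]_3) (P : 'M[R]_3)
    (phi : 'cV[R]_3) :
  stochastic P -> mu *m P = mu ->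
  let x := phi st1 0 in let y := phi st2 0 in let z := phi st3 0 in
  three_point mu (diag_mx phi^T) 1%:M P - three_point mu (diag_mx phi^T) P 1%:M
  = - (flux mu P * ((x - y) * (y - z) * (z - x))).
Proof.
move=> [_ P1] muP x y z; rewrite /three_point /flux.
have sum3 (f : 'I_3 -> R) : \sum_i f i = f st1 + f st2 + f st3.
  rewrite !big_ord_recl big_ord0 addr0 addrA.
  by congr (f _ + f _ + f _); apply: val_inj.
have P11 : P st1 st1 = 1 - P st1 st2 - P st1 st3 by rewrite -(P1 st1) sum3; ring.
have P22 : P st2 st2 = 1 - P st2 st1 - P st2 st3 by rewrite -(P1 st2) sum3; ring.
have bal j : mu 0 st1 * P st1 j + mu 0 st2 * P st2 j + mu 0 st3 * P st3 j = mu 0 j.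
  by rewrite -[RHS](congr1 (fun v : 'rV_3 => v 0 j) muP) mxE sum3.
have flux23 : mu 0 st2 * P st2 st3 - mu 0 st3 * P st3 st2
    = mu 0 st1 * P st1 st2 - mu 0 st2 * P st2 st1.
  have := bal st2; rewrite P22 => /eqP; rewrite -subr_eq0 => /eqP b2.
  by apply/eqP; rewrite -subr_eq0 -oppr_eq0 -b2; apply/eqP; ring.
have flux31 : mu 0 st3 * P st3 st1 - mu 0 st1 * P st1 st3
    = mu 0 st1 * P st1 st2 - mu 0 st2 * P st2 st1.
  have := bal st1; rewrite P11 => /eqP; rewrite -subr_eq0 => /eqP b1.
  by apply/eqP; rewrite -subr_eq0 -b1; apply/eqP; ring.
rewrite !mulmx1 !mul_mx_diag !mxE !sum3 !mxE !sum3 !mxE -/x -/y -/z.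
transitivity ((mu 0 st1 * P st1 st2 - mu 0 st2 * P st2 st1) * (x * y * (x - y))
  + (mu 0 st2 * P st2 st3 - mu 0 st3 * P st3 st2) * (y * z * (y - z))
  + (mu 0 st3 * P st3 st1 - mu 0 st1 * P st1 st3) * (z * x * (z - x))).
  ring.
rewrite flux23 flux31; ring.
Qed.

(** * Conditioning on finitely many values *)

Section ProbabilityFacts.
Variables (d : measure_display) (T : measurableType d) (R : realType).
Variable Pr : probability T R.

Lemma prob_partition (I : finType) (Z : T -> I) (A : set T) :
  measurable A -> (forall z, measurable [set w | Z w = z]) ->
  prob Pr A = \sum_z prob Pr (A `&` [set w | Z w = z]).
Proof.
move=> mA mZ.
have AE : A = \bigcup_(z in [set: I]) (A `&` [set w | Z w = z]).
  by apply/seteqP; split=> [w Aw|w [z _ []//]]; exists (Z w).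
have mAZ z : measurable (A `&` [set w | Z w = z]) by exact: measurableI.
rewrite /prob {1}AE measure_fin_bigcup //; last first.
- by move=> z z' _ _ [w [[_ /= <-] [_ /= <-]]].
- exact: finite_finset.
rewrite (@fsbigE _ _ _ _ _ (index_enum I)) ?index_enum_uniq //; first last.
  by move=> z _; rewrite mem_index_enum.
rewrite -sum_fine => [|z _]; last exact: fin_num_measure.
by apply: eq_bigl => z; rewrite in_setT.
Qed.

(** Pr(A | B) = q as soon as Pr(A | Z = z) = q for every value z of Z compatible
    with B, when B is determined by Z. The conditional
    probabilities are multiplied out so that null events are covered too. *)
Lemma prob_refine (I : finType) (Z : T -> I) (A B : set T) (q : R) :
  measurable A -> measurable B -> (forall z, measurable [set w | Z w = z]) ->
  (forall w w', Z w = Z w' -> B w -> B w') ->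
  (forall w, B w -> prob Pr (A `&` [set w' | Z w' = Z w])
                    = q * prob Pr [set w' | Z w' = Z w]) ->
  prob Pr (A `&` B) = q * prob Pr B.
Proof.
move=> mA mB mZ ZB cond.
rewrite (prob_partition (measurableI _ _ mA mB) mZ) (prob_partition mB mZ).
rewrite mulr_sumr; apply: eq_bigr => z _; rewrite -setIA.
have [[w [Bw Zw]]|BZ0] := pselect (exists w, B w /\ Z w = z); last first.
  suff -> : B `&` [set w | Z w = z] = set0 by rewrite setI0 /prob measure0 mulr0.
  by apply/seteqP; split=> [w [Bw Zw]|//]; apply: BZ0; exists w.
rewrite -Zw; suff -> : B `&` [set w' | Z w' = Z w] = [set w' | Z w' = Z w].
  exact: cond.
by apply/seteqP; split=> [w' []//|w' /= Zw']; split=> //; apply: ZB Bw.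
Qed.

Lemma measurable_values (k : nat) (X : nat -> T -> 'I_k) (D : set nat)
    (x : nat -> 'I_k) :
  discrete_process X -> measurable [set w | forall u, D u -> X u w = x u].
Proof.
move=> mX.
rewrite (_ : [set _ | _] = \bigcap_(u in D) [set w | X u w = x u]).
  by apply: bigcap_measurableType => u _; apply: mX.
by apply/seteqP; split.
Qed.

Lemma prob_eq0_sub (A B : set T) : measurable A -> measurable B ->
  A `<=` B -> prob Pr B = 0 -> prob Pr A = 0.
Proof.
move=> mA mB AB B0; apply/eqP; rewrite eq_le fine_ge0 // andbT -B0.
by rewrite fine_le ?fin_num_measure // le_measure ?inE.
Qed.

(** A null conditioning event makes both sides vanish. *)
Lemma prob_cond (A B : set T) (q : R) : measurable A -> measurable B ->
  (prob Pr B != 0 -> cond_prob Pr A B = q) ->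
  prob Pr (A `&` B) = q * prob Pr B.
Proof.
move=> mA mB; rewrite /cond_prob; have [B0 _|B0 <- //] := eqVneq (prob Pr B) 0.
  by rewrite B0 mulr0; apply: prob_eq0_sub B0 => //; exact: measurableI.
by rewrite divfK.
Qed.

End ProbabilityFacts.

(** * The forward recursion of a hidden Markov model *)

Section ForwardRecursion.
Variables (d : measure_display) (T : measurableType d) (R : realType).
Variables (Pr : probability T R) (k K : nat) (mu : 'rV[R]_k.+1).
Variables (P : 'M[R]_k.+1) (Pi : 'M[R]_(k.+1, K)).
Variables (C : nat -> T -> 'I_k.+1) (S : nat -> T -> 'I_K).
Hypothesis CS_hmm : hidden_markov_model Pr mu P Pi C S.

Let mC : discrete_process C. Proof. by case: CS_hmm => -[]. Qed.
Let mS : discrete_process S. Proof. by case: CS_hmm. Qed.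

Let measurable_history t c s u :
  measurable (history C t c `&` history S u s).
Proof. by apply: measurableI; apply: measurable_values. Qed.

(** The model specifies conditional laws only given a complete history of states
    and observations. They extend to any event B that depends on the first a
    states and the first b observations, which is what allows most of the
    observations to be left unspecified. *)
Lemma prob_history_refine (q : R) (a b : nat) (A B : set T) :
  measurable A -> measurable B ->
  (forall w w', (forall u, (u < a)%N -> C u w = C u w') ->
     (forall u, (u < b)%N -> S u w = S u w') -> B w -> B w') ->
  (forall w, B w -> let H := history C a (C^~ w) `&` history S b (S^~ w) in
     prob Pr (A `&` H) = q * prob Pr H) ->
  prob Pr (A `&` B) = q * prob Pr B.
Proof.
move=> mA mB BH cond.
pose Z w := ([ffun u : 'I_a => C u w], [ffun u : 'I_b => S u w]).
have ZP w w' : Z w' = Z w <->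
    (history C a (C^~ w) `&` history S b (S^~ w)) w'.
  split=> [[/ffunP ZC /ffunP ZS]|[HC HS]].
    split=> u ub; first by have := ZC (Ordinal ub); rewrite !ffunE.
    by have := ZS (Ordinal ub); rewrite !ffunE.
  by congr pair; apply/ffunP => u; rewrite !ffunE ?HC ?HS.
have ZE w : [set w' | Z w' = Z w] = history C a (C^~ w) `&` history S b (S^~ w).
  by apply/seteqP; split=> w' /ZP.
apply: (prob_refine (Z := Z)) => //.
- move=> z; have [[w <-]|Z0] := pselect (exists w, Z w = z); first by rewrite ZE.
  rewrite (_ : [set _ | _] = set0) //.
  by apply/seteqP; split=> // w Zw; apply: Z0; exists w.
- by move=> w w' /esym/ZP[HC HS]; apply: BH => u ub; rewrite ?HC ?HS.
- by move=> w /cond; rewrite ZE.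
Qed.

(** Prescribing the observations at the times in J alone makes one recursion
    serve for observations separated by arbitrary gaps. *)
Variables (J : pred nat) (s : nat -> 'I_K).

Definition observed (t : nat) : set T :=
  [set w | forall u, (u < t)%N && J u -> S u w = s u].

Definition forward (t : nat) : 'rV[R]_k.+1 :=
  \row_x prob Pr ([set w | C t w = x] `&` observed t).

Definition emission (t : nat) : 'M[R]_k.+1 :=
  if J t then diag_mx (col (s t) Pi)^T else 1%:M.

Let measurable_observed t : measurable (observed t).
Proof. exact: measurable_values. Qed.

Let measurable_state_observed t x u :
  measurable ([set w | C t w = x] `&` observed u).
Proof. by apply: measurableI => //; apply: mC. Qed.

Lemma forward0 : forward 0 = mu.
Proof.
apply/rowP => x; rewrite mxE; case: CS_hmm => -[_ <- _] _ _ _.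
by congr prob; apply/seteqP; split=> [w []//|w ?]; split.
Qed.

Lemma observedS t : observed t.+1 =
  if J t then [set w | S t w = s t] `&` observed t else observed t.
Proof.
case: ifP => Jt; apply/seteqP; split=> w.
- move=> H; split=> [|u /andP[ut Ju]]; first by apply: H; rewrite ltnSn.
  by apply: H; rewrite ltnW.
- move=> [Ht H] u; rewrite ltnS leq_eqVlt => /andP[/predU1P[->//|ut] Ju].
  by apply: H; rewrite ut.
- by move=> H u /andP[ut Ju]; apply: H; rewrite ltnW.
- move=> H u; rewrite ltnS leq_eqVlt => /andP[/predU1P[->|ut] Ju].
    by rewrite Ju in Jt.
  by apply: H; rewrite ut.
Qed.

(** By prob_history_refine with the states up to t and the observations before t:
    the new observation depends on this past through C_t only. *)
Lemma forward_emission t x :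
  prob Pr ([set w | C t w = x] `&` observed t.+1)
  = (forward t *m emission t) 0 x.
Proof.
rewrite observedS /emission; case: ifP => Jt; last by rewrite mulmx1 mxE.
rewrite mul_mx_diag !mxE mulrC setICA.
apply: (@prob_history_refine _ t.+1 t); [exact: mS|by []| |].
  move=> w w' HC HS [<- Ow]; split=> [|u /andP[ut Ju]]; first by rewrite /= HC.
  by rewrite -HS // Ow // ut.
move=> w [<- _] /=; apply: (prob_cond (mS _ _) (measurable_history _ _ _ _)).
by case: CS_hmm => _ _ + _ => /[apply].
Qed.

(** By prob_history_refine with states and observations up to t: as there is no
    feedback from the observations to the chain, the next state depends on this
    past through C_t only. *)
Lemma forwardS t : forward t.+1 = forward t *m emission t *m P.
Proof.
apply/rowP => y; rewrite !mxE (prob_partition Pr _ (mC t)) //.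
apply: eq_bigr => x _; rewrite -forward_emission -setIA mulrC.
rewrite (setIC (observed _)).
apply: (@prob_history_refine _ t.+1 t.+1); [exact: mC|by []| |].
  move=> w w' HC HS [<- Ow]; split=> [|u /andP[ut Ju]]; first by rewrite /= HC.
  by rewrite -HS // Ow // ut.
move=> w [<- _] /=; apply: (prob_cond (mC _ _) (measurable_history _ _ _ _)).
move=> H0; case: CS_hmm => -[_ _ Cstep] _ _ no_feedback.
rewrite no_feedback // Cstep //; apply: contraNneq H0 => H0.
apply/eqP; apply: prob_eq0_sub H0 => //; exact: measurable_values.
Qed.

Lemma prob_observed t :
  prob Pr (observed t.+1) = (forward t *m emission t *m all_ones R k.+1) 0 0.
Proof.
rewrite (prob_partition Pr _ (mC t)) // mxE; apply: eq_bigr => x _.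
by rewrite [all_ones _ _ _ _]mxE mulr1 -forward_emission setIC.
Qed.

(** At unprescribed times the emission matrix is the identity, so the recursion
    multiplies by P alone. *)
Lemma forward_free t l : (forall u, (t < u < t + l)%N -> ~~ J u) ->
  (0 < l)%N -> forward (t + l) = forward t *m emission t *m P ^+ l.
Proof.
elim: l => // l IHl Jfree _; rewrite addnS forwardS.
case: l IHl Jfree => [|l] IHl Jfree; first by rewrite addn0 expr1.
rewrite IHl // => [|u /andP[tu ul]]; last by rewrite Jfree // tu addnS ltnW.
rewrite {2}/emission ifN ?mulmx1 ?(exprSr _ l.+1) -?mulmxE ?mulmxA //.
by apply: Jfree; rewrite !addnS !ltnS leqnn leq_addr.
Qed.

End ForwardRecursion.

Lemma prob_three_observations (d : measure_display) (T : measurableType d)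
    (R : realType) (Pr : probability T R) (k K : nat) (mu : 'rV[R]_k.+1)
    (P : 'M[R]_k.+1) (Pi : 'M[R]_(k.+1, K))
    (C : nat -> T -> 'I_k.+1) (S : nat -> T -> 'I_K) (i : 'I_K) (n m : nat) :
  hidden_markov_model Pr mu P Pi C S -> (0 < n)%N -> (0 < m)%N ->
  let L := diag_mx (col i Pi)^T in
  prob Pr [set w | [/\ S 0%N w = i, S n w = i & S (n + m)%N w = i]]
  = three_point mu L (P ^+ n) (P ^+ m).
Proof.
move=> hmm n_gt0 m_gt0 L; rewrite /three_point.
pose J : pred nat := fun u => u \in [:: 0; n; n + m]%N.
have -> : [set w | [/\ S 0%N w = i, S n w = i & S (n + m)%N w = i]]
    = observed S J (fun=> i) (n + m).+1.
  apply/seteqP; split=> w /=.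
    by move=> [S0 Sn Snm] u /andP[_]; rewrite /J !inE => /or3P[]/eqP->.
  move=> H; split; apply: H; apply/andP; split;
    by rewrite ?ltnS ?leq_addr // /J ?inE ?eqxx ?orbT.
have emL u : J u -> emission Pi J (fun=> i) u = L by rewrite /emission => ->.
(* The recursion runs without observations between n and n + m, then between 0
   and n. *)
rewrite (prob_observed hmm) (forward_free hmm) //; last first.
  by move=> u /andP[nu unm]; rewrite /J !inE; lia.
rewrite -[n in forward _ _ _ _ _ n]add0n (forward_free hmm) //; last first.
  by move=> u /andP[nu unm]; rewrite /J !inE; lia.
rewrite (forward0 hmm) !emL //; by rewrite /J ?inE ?eqxx ?orbT.
Qed.

(** * The asymmetry of three observations under exchange of the gaps *)

Unset Implicit Arguments.

Theorem theorem4p3 (R : realType) (d : measure_display) (T : measurableType d)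
    (Pr : probability T R) (K : nat) (mu : 'rV[R]_3) (P : 'M[R]_3)
    (Pi : 'M[R]_(3, K)) (C : nat -> T -> 'I_3) (S : nat -> T -> 'I_K)
    (l1 l2 : R[i])
    (P_stochastic : stochastic P) (P_irreducible : irreducible_chain P)
    (mu_stationary : stationary_distribution mu P)
    (Pi_stochastic : stochastic Pi)
    (CS_hmm : hidden_markov_model Pr mu P Pi C S)
    (Q_spectrum : spectrum (P - 1%:M) [:: 0; - l1; - l2])
    (l1_neq0 : l1 != 0) (l2_neq0 : l2 != 0)
    (i : 'I_K) (n m : nat) (n_gt0 : (0 < n)%N) (m_gt0 : (0 < m)%N) :
  let phi := col i Pi in
  let x := phi st1 0 in
  let y := phi st2 0 in
  let z := phi st3 0 in
  let D := (x - y) * (y - z) * (z - x) in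
  (prob Pr [set w | [/\ S 0%N w = i, S n w = i & S (n + m)%N w = i]]
   - prob Pr [set w | [/\ S 0%N w = i, S m w = i & S (m + n)%N w = i]])%:C
  = (flux mu P * D)%:C * bracket_quotient l1 l2 n m.
Proof.
move=> phi x y z D; set L := diag_mx phi^T.
rewrite (prob_three_observations _ CS_hmm) // (prob_three_observations _ CS_hmm) //.
rewrite rmorphB /= -!map_three_point.
have [_ _ muP] := mu_stationary.
have [c quad] := quadratic_projection P_stochastic P_irreducible
  mu_stationary Q_spectrum.
set f := real_complex R in quad *; set PC := map_mx f P in quad.
set muC := map_mx f mu in quad *; set E := all_ones _ 3 *m muC in quad.
have EP : E *m PC = E by rewrite -mulmxA -map_mxM muP.
have [g Pn] := pow_interpolation n EP quad.
have [g' Pm] := pow_interpolation m EP quad.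
have fX k : map_mx f (P ^+ k) = PC ^+ k by rewrite rmorphXn.
rewrite !fX Pn Pm three_point_swap -(map_mx1 f) !map_three_point -rmorphB /=.
rewrite three_point_flux // -/D bracket_quotientE rmorphN /=; ring.
Qed.
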